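(* Let $N\ge 2$ and $n\ge 3$. The graph-coloring subshift $\mathcal{C}_n\subseteq\{0,\ldots,n-1\}^{\mathrm{BS}(1,N)}$ contains a frozen coloring if and only if $n=3$.
   Context: $\mathrm{BS}(1,N)=\langle a,b\mid bab^{-1}=a^N\rangle$. For $n\ge2$, the graph-coloring subshift is $$\mathcal{C}_n=\{x\in\{0,\ldots,n-1\}^{\mathrm{BS}(1,N)} : x_g\ne x_{gs}\text{ for all } g\in \mathrm{BS}(1,N),\ s\in\{a,b\}\},$$ i.e. the set of proper $n$-colorings of the right Cayley graph of $\mathrm{BS}(1,N)$ with respect to $\{a,b\}$. For $n\ge 3$, a configuration $x\in\mathcal{C}_n$ is a frozen coloring if every $y\in\mathcal{C}_n$ for which there is a non-empty finite set $F\subseteq\mathrm{BS}(1,N)$ with $x|_{F^c}=y|_{F^c}$ satisfies $y=x$. *)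

(* Defs.v *)
From HB Require Import structures.
From mathcomp Require Import all_boot monoid generic_quotient.
From mathcomp Require Import boolp classical_sets cardinality.

Set Implicit Arguments.
Unset Strict Implicit.
Unset Printing Implicit Defensive.

Local Open Scope quotient_scope.

(* BS(1,N) = <a, b | b a b^-1 = a^N>, as the quotient of the words in
   a, b, a^-1, b^-1 by the congruence generated by free cancellation and by the
   defining relation. A letter is a pair (generator, inverted?), the generator
   being a when false and b when true. *)

Definition bs_letter := (bool * bool)%type.
Definition bs_word := seq bs_letter.

Definition la : bs_letter := (false, false).
Definition lb : bs_letter := (true, false).
Definition linv (l : bs_letter) : bs_letter := (l.1, ~~ l.2).
Definition winv (w : bs_word) : bs_word := rev (map linv w).

Inductive bs_cong (N : nat) : bs_word -> bs_word -> Prop :=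
| BSrefl w : bs_cong N w w
| BSsym w1 w2 : bs_cong N w1 w2 -> bs_cong N w2 w1
| BStrans w1 w2 w3 : bs_cong N w1 w2 -> bs_cong N w2 w3 -> bs_cong N w1 w3
| BSctx u v w1 w2 : bs_cong N w1 w2 -> bs_cong N (u ++ w1 ++ v) (u ++ w2 ++ v)
| BScancel l : bs_cong N [:: l; linv l] [::]
| BSrel : bs_cong N [:: lb; la; linv lb] (nseq N la).

Definition bs_congb (N : nat) : rel bs_word := fun u v => `[< bs_cong N u v >].

Section BSGroup.
Variable N : nat.

Lemma bs_congb_refl : reflexive (bs_congb N).
Proof. by move=> w; apply/asboolP; apply: BSrefl. Qed.

Lemma bs_congb_sym : symmetric (bs_congb N).
Proof. by move=> u v; apply/asboolP/asboolP; apply: BSsym. Qed.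

Lemma bs_congb_trans : transitive (bs_congb N).
Proof.
move=> v u w /asboolP uv /asboolP vw; apply/asboolP; exact: BStrans uv vw.
Qed.

Canonical bs_equiv : equiv_rel bs_word :=
  EquivRel (bs_congb N) bs_congb_refl bs_congb_sym bs_congb_trans.

Definition BS : Type := {eq_quot bs_equiv}.
HB.instance Definition _ := Choice.on BS.
HB.instance Definition _ := Quotient.on BS.

Definition bs_cl (w : bs_word) : BS := \pi_BS w.
Definition bs_mul (x y : BS) : BS := bs_cl (repr x ++ repr y).
Definition bs_inv (x : BS) : BS := bs_cl (winv (repr x)).

Lemma bs_clP u v : bs_cl u = bs_cl v <-> bs_cong N u v.
Proof.
split=> [/eqmodP/asboolP //|uv]; by apply/eqmodP/asboolP.
Qed.

Lemma bs_clK x : bs_cl (repr x) = x.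
Proof. exact: reprK. Qed.

Lemma bs_cong_repr w : bs_cong N (repr (bs_cl w)) w.
Proof. by apply/bs_clP; rewrite bs_clK. Qed.

Lemma bs_cong_cat u u' v v' :
  bs_cong N u u' -> bs_cong N v v' -> bs_cong N (u ++ v) (u' ++ v').
Proof.
move=> uu' vv'; apply: (@BStrans _ _ (u' ++ v)).
  exact: (@BSctx N [::] v).
by have := @BSctx N u' [::] _ _ vv'; rewrite !cats0.
Qed.

Lemma bs_mulE u v : bs_mul (bs_cl u) (bs_cl v) = bs_cl (u ++ v).
Proof. by apply/bs_clP; apply: bs_cong_cat; apply: bs_cong_repr. Qed.

Lemma linvK : involutive linv.
Proof. by case=> s e; rewrite /linv /= negbK. Qed.

Lemma winvK : involutive winv.
Proof. by move=> w; rewrite /winv map_rev revK mapK //; apply: linvK. Qed.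

Lemma bs_cong_winvr w : bs_cong N (w ++ winv w) [::].
Proof.
elim: w => [|l w IHw]; first exact: BSrefl.
rewrite /winv /= rev_cons -cats1 catA -cat1s -(cat1s _ [::]) cats0 -catA.
rewrite -/(winv w); apply: (@BStrans _ _ [:: l; linv l]); last exact: BScancel.
by have := @BSctx N [:: l] [:: linv l] _ _ IHw; rewrite /= catA.
Qed.

Lemma bs_mulA : associative bs_mul.
Proof.
by move=> x y z; rewrite -[x]bs_clK -[y]bs_clK -[z]bs_clK !bs_mulE catA.
Qed.

Lemma bs_mul1g : left_id (bs_cl [::]) bs_mul.
Proof. by move=> x; rewrite -[x]bs_clK bs_mulE. Qed.

Lemma bs_mulg1 : right_id (bs_cl [::]) bs_mul.
Proof. by move=> x; rewrite -[x]bs_clK bs_mulE cats0. Qed.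

Lemma bs_mulgV : right_inverse (bs_cl [::]) bs_inv bs_mul.
Proof.
move=> x; rewrite -{1}[x]bs_clK bs_mulE; apply/bs_clP; exact: bs_cong_winvr.
Qed.

Lemma bs_mulVg : left_inverse (bs_cl [::]) bs_inv bs_mul.
Proof.
move=> x; rewrite -{2}[x]bs_clK bs_mulE; apply/bs_clP.
by rewrite -{2}[repr x]winvK; apply: bs_cong_winvr.
Qed.

HB.instance Definition _ :=
  isGroup.Build BS bs_mulA bs_mul1g bs_mulg1 bs_mulVg bs_mulgV.

Definition bs_a : BS := bs_cl [:: la].
Definition bs_b : BS := bs_cl [:: lb].

Lemma bs_relation : (bs_b * bs_a * bs_b^-1 = bs_a ^+ N)%g.
Proof.
have -> : (bs_b^-1 = bs_cl [:: linv lb])%g.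
  rewrite -[LHS]mulg1.
  have -> : (1 = bs_b * bs_cl [:: linv lb])%g.
    by rewrite [RHS]bs_mulE; apply/esym/bs_clP; apply: BScancel.
  by rewrite mulgA mulVg mul1g.
have -> : (bs_a ^+ N = bs_cl (nseq N la))%g.
  elim: N => [//|k IHk]; by rewrite expgS IHk [LHS]bs_mulE.
rewrite [(bs_b * bs_a)%g]bs_mulE [LHS]bs_mulE; apply/bs_clP; exact: BSrel.
Qed.

End BSGroup.

Local Open Scope classical_set_scope.
Local Open Scope group_scope.

Definition graph_coloring (N n : nat) : set (BS N -> 'I_n) :=
  [set x | forall g s : BS N, [set bs_a N; bs_b N] s -> x g <> x (g * s)].

Definition frozen_coloring (N n : nat) (x : BS N -> 'I_n) : Prop :=
  graph_coloring x /\
  forall y : BS N -> 'I_n, graph_coloring y ->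
    (exists F : set (BS N), [/\ F !=set0, finite_set F &
       forall g, (~` F) g -> x g = y g]) ->
    y = x.

(* Main.v *)
Require Import Defs.
From mathcomp Require Import all_boot.
From mathcomp Require Import order ssralg ssrnum ssrint rat zmodp monoid.
From mathcomp Require Import boolp classical_sets cardinality.
From mathcomp Require Import zify ring.

(**
For n >= 4, every coloring can be changed along one finite cycle.  The relator
gives the cycle 1, a, ..., a^N, a^N b = b a, b, which is induced in the Cayley
graph; each of its vertices has only two neighbors outside it, so besides its
own color it has at least one more color that differs from those two.  A cycle
that is properly colored and in which every vertex has a second color at its
disposal always has a second proper coloring ([cyclic_recoloring]): replace
the colors along a suitable arc, or along the whole cycle.  Hence no coloring
is frozen ([not_frozen_coloring]).

For n = 3, a coloring is frozen as soon as the vertices carry a rank in a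
total order such that every vertex has two neighbors of larger rank and of
different colors ([frozen_of_rank]): at a vertex of maximal rank in a finite
set of modified vertices these two neighbors are unchanged and leave only the
old color.  The ranks come from the action of BS(1,N) on pairs (t, m), where a
adds N^m to t and b increments m; t grows along a and stays constant along b.

If N >= 3, the exponent of a is well defined modulo N - 1, and Z/(N-1) with its
successor relation is a cycle with a proper 3-coloring w. The coloring m +
w(exponent of a) modulo 3 increases by 1 along b, while its increment along a
is +1 or -1 and depends only on the column, that is, on the left coset of <b>
through g. So ga has the color of gb throughout the column, or that of g b^-1
throughout. Order the group by t, and within a column by -m in the first case
and by m in the second; then ga and one of gb, g b^-1 are above g and have
different colors ([frozen_coloring_ge3]).

If N = 2, that exponent carries no information.  Instead b decreases the color
by 1 and a changes it by +1 or -1 with a sign that flips along b; the relation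
holds since 2 = -1 modulo 3.  Order by m, and on a level by t or by -t
according to the sign; then gb and one of ga, g a^-1 are above g and have
different colors ([frozen_coloring_2]).
*)

Set Implicit Arguments.
Unset Strict Implicit.
Unset Printing Implicit Defensive.

Import Order.TTheory GRing.Theory Num.Theory.

(** * Actions of the Baumslag-Solitar group given on generators *)

(** A right action of BS(1,N): words are read from left to right, so
the relation b a b^-1 = a^N applies b first. *)
Record bs_action (N : nat) (X : Type) := BsAction {
  act_a : X -> X;
  act_aV : X -> X;
  act_b : X -> X;
  act_bV : X -> X;
  act_aK : cancel act_a act_aV;
  act_aVK : cancel act_aV act_a;
  act_bK : cancel act_b act_bV;
  act_bVK : cancel act_bV act_b;
  act_rel : forall x, act_bV (act_a (act_b x)) = iter N act_a x }.

Definition act_letter N X (A : bs_action N X) (x : X) (l : bs_letter) : X :=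
  if l.1 then (if l.2 then act_bV A x else act_b A x)
  else (if l.2 then act_aV A x else act_a A x).

Definition walk N X (A : bs_action N X) (x0 : X) (g : BS N) : X :=
  foldl (act_letter A) x0 (repr g).

Lemma act_cong N X (A : bs_action N X) u v : bs_cong N u v ->
  forall x, foldl (act_letter A) x u = foldl (act_letter A) x v.
Proof.
elim=> {u v}.
- by [].
- by move=> u v _ IH x; rewrite IH.
- by move=> u v w _ IHuv _ IHvw x; rewrite IHuv IHvw.
- by move=> u v w1 w2 _ IH x; rewrite !foldl_cat IH.
- by case: A => a aV b bV aK aVK bK bVK rel [[] []] x; rewrite /act_letter /=.
- move=> x; rewrite [LHS](act_rel A).
  have gen k y : iter k (act_a A) y = foldl (act_letter A) y (nseq k la).
    by elim: k y => //= k IHk y; rewrite -IHk -iterS iterSr.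
  exact: gen.
Qed.

Lemma walk_cl N X (A : bs_action N X) x0 w :
  walk A x0 (bs_cl N w) = foldl (act_letter A) x0 w.
Proof. exact/act_cong/bs_cong_repr. Qed.

Lemma walk1 N X (A : bs_action N X) x0 : walk A x0 1%g = x0.
Proof. exact: walk_cl. Qed.

Lemma walk_a N X (A : bs_action N X) x0 g :
  walk A x0 (g * bs_a N)%g = act_a A (walk A x0 g).
Proof. by rewrite -[g]bs_clK [(_ * _)%g]bs_mulE !walk_cl foldl_cat. Qed.

Lemma walk_b N X (A : bs_action N X) x0 g :
  walk A x0 (g * bs_b N)%g = act_b A (walk A x0 g).
Proof. by rewrite -[g]bs_clK [(_ * _)%g]bs_mulE !walk_cl foldl_cat. Qed.

Lemma walk_aV N X (A : bs_action N X) x0 g :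
  walk A x0 (g * (bs_a N)^-1)%g = act_aV A (walk A x0 g).
Proof. by rewrite -[in RHS](mulgVK (bs_a N) g) walk_a act_aK. Qed.

Lemma walk_bV N X (A : bs_action N X) x0 g :
  walk A x0 (g * (bs_b N)^-1)%g = act_bV A (walk A x0 g).
Proof. by rewrite -[in RHS](mulgVK (bs_b N) g) walk_b act_bK. Qed.

(** * A second coloring of a cycle *)

(** The cycle 0, ..., K is colored by c, and d proposes a second color at each
vertex.  Since [d K] differs from the color [c 0] after it, K may change to its
second color unless K - 1 has that color; then K - 1 changes too, and so on.
This stops at some p > 0 and recolors [p, K], or it runs through all vertices,
which is a recoloring unless [d 0 = d K].  In that case [d 0] differs from
[c K], and the same propagation starts at 0 and goes up.  If it does not stop
either, the colors c alternate along 0, ..., K with [c (K - 1) = c 1], so K is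
even and [c K = c 0], which is absurd on a cycle. *)
Lemma linear_recoloring (T : eqType) (K : nat) (c d : nat -> T) :
  0 < K ->
  (forall i, c i != d i) -> (forall i, c i != c i.+1) -> c K.+1 = c 0 ->
  d K != c 0 ->
  exists p q, [/\ p <= q, q <= K &
    let e i := if p <= i <= q then d i else c i in
    (forall i, i < K -> e i != e i.+1) /\ e K != e 0].
Proof.
move=> K0 dc cc cK dK.
pose L (i : 'I_K.+1) := (0 < i) && (d i != c i.-1).
case: (pickP L) => [i0 Li0|noL].
  have [p /andP[p0 dp] pmax] := arg_maxnP val Li0.
  exists p, K; split=> //; [by rewrite -ltnS | split=> [i iK|]].
    have [lt_pi|lt_ip|eq_pi] := ltngtP i.+1 p.
    - by rewrite !ifF ?cc //; lia.
    - case: (boolP (L (@Ordinal K.+1 i.+1 iK))) => [/pmax /=|/negPn/eqP /= di].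
        by lia.
      by rewrite !ifT; [rewrite di eq_sym|lia|lia].
    - rewrite ifF; last lia.
      by rewrite ifT; [move: dp; rewrite -eq_pi eq_sym|lia].
  by rewrite ifT; [rewrite ifF//; lia|rewrite leqnn -ltnS ltn_ord].
have dl i : i < K -> d i.+1 = c i.
  move=> iK; have := noL (@Ordinal K.+1 i.+1 iK).
  by rewrite /L /= => /negPn/eqP.
case: (eqVneq (d 0) (d K)) => [d0K|d0K]; last first.
  exists 0, K; split=> //=; split=> [i iK|].
    by rewrite ifT ?ifT ?dl 1?eq_sym //; lia.
  by rewrite ifT ?leqnn // eq_sym.
(* From here on [d 0 = d K]: the propagation restarts at 0, going up. *)
have dKl : d K = c K.-1 by rewrite -(dl K.-1) ?prednK // ltn_predL.
pose R (i : 'I_K) := d i != c i.+1.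
case: (pickP R) => [i0 Ri0|noR].
  have [q dq qmin] := arg_minnP val Ri0; have qK := ltn_ord q.
  exists 0, q; split=> //; [exact/ltnW|split=> [i iK|]].
    have [lt_iq|lt_qi|eq_iq] := ltngtP i q.
    - case: (boolP (R (Ordinal iK))) => [/qmin /=|/negPn/eqP /= di].
        by lia.
      by rewrite /= di.
    - exact: cc.
    - by rewrite /= eq_iq.
  rewrite ifF; last lia.
  by rewrite /= d0K dKl eq_sym -{2}(prednK K0) cc.
have dr i : i < K -> d i = c i.+1.
  by move=> iK; have := noR (Ordinal iK) => /negPn/eqP.
have alt j : j <= K -> c j = c (odd j).
  elim/ltn_ind: j => -[|[|j]] IH //= jK.
  by rewrite negbK -IH; [rewrite -dr ?dl//; lia|lia|lia].
have c1 : c K.-1 = c 1 by rewrite -dKl -d0K dr.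
have c01 := cc 0.
have oddK : odd K = false.
  apply/negbTE/negP => oK; move/eqP: c01; apply.
  rewrite -c1 (alt K.-1) ?leq_pred //.
  case: K K0 oK {dK cK L noL dl d0K dKl R noR dr alt c1} => //= k _.
  by move=> /negbTE ->.
by have := cc K; rewrite cK (alt K) // oddK eqxx.
Qed.

(** If every second color is the color of the next vertex, rotating the colors
by one step works; otherwise the cycle can be opened after a vertex whose
second color is not that of its successor. *)
Lemma cyclic_recoloring (T : eqType) (K : nat) (c d : nat -> T) :
  0 < K ->
  (forall i, c (i + K.+1) = c i) -> (forall i, d (i + K.+1) = d i) ->
  (forall i, c i != d i) -> (forall i, c i != c i.+1) ->
  exists s p q, [/\ p <= q, q <= K &
    let e i := if p <= i <= q then d (s + i) else c (s + i) in
    (forall i, i < K -> e i != e i.+1) /\ e K != e 0].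
Proof.
move=> K0 cK dK cd cc; have [dc|] := pselect (forall i, d i = c i.+1).
  exists 0, 0, K; split=> //=; split=> [i iK|]; last first.
    by rewrite leqnn !add0n !dc -[K.+1]add0n cK cc.
  by rewrite iK ltnW // !add0n !dc cc.
move/existsNP=> [j /eqP dj].
have [//|||||p [q pq]] := @linear_recoloring _ K
    (fun i => c (j.+1 + i)) (fun i => d (j.+1 + i)).
- by move=> i; apply: cd.
- by move=> i; rewrite addnS; apply: cc.
- by rewrite cK addn0.
- by rewrite addn0 addSnnS dK.
by exists j.+1, p, q.
Qed.

Lemma fresh_color (n : nat) (s : seq 'I_n) : size s < n -> exists z, z \notin s.
Proof.
move=> sn; case: (pickP (fun z => z \notin s)) => [z zs|all_s].
  by exists z.
have : #|'I_n| <= #|s|.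
  apply/subset_leq_card/fintype.subsetP => z _.
  by rewrite -[_ \in _]negbK all_s.
by rewrite card_ord leqNgt (leq_ltn_trans (card_size s)).
Qed.

(** The cycle v is indexed periodically.  A vertex avoids its own color
and those of its two outer neighbors, at most three colors in all, so a fourth
color gives the second color that the recoloring of a cycle asks for.  That the
outer neighbors lie outside the whole cycle makes it chordless. *)
Lemma recolor_induced_cycle (T : choiceType) (n K : nat) (nbr : T -> T -> Prop)
    (x : T -> 'I_n) (v : nat -> T) :
  3 < n -> 0 < K ->
  (forall g h, nbr g h -> nbr h g) ->
  (forall g h, nbr g h -> x g <> x h) ->
  (forall i, v (i + K.+1) = v i) ->
  (forall i j, v i = v j -> i = j %[mod K.+1]) ->
  (forall i, nbr (v i) (v i.+1)) ->
  (forall i, exists o1 o2,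
     (forall j, o1 <> v j /\ o2 <> v j) /\
     (forall h, nbr (v i.+1) h -> [\/ h = v i, h = v i.+2, h = o1 | h = o2])) ->
  exists y : T -> 'I_n,
    [/\ forall g h, nbr g h -> y g <> y h, y <> x
      & forall g, (forall i, g <> v i) -> y g = x g].
Proof.
move=> n4 K0 nbrC xP vK v_inj v_nbr deg4.
have chordless i j : nbr (v i.+1) (v j) -> v j = v i \/ v j = v i.+2.
  have [o1 [o2 [out o12]]] := deg4 i.
  by case/o12=> [||vo|vo]; [left|right|case: (out j).1|case: (out j).2].
have vS i : exists j, v i = v j.+1 by exists (i + K); rewrite -addnS vK.
have freshD g : exists z, z <> x g /\
    ((exists i, g = v i) ->
     forall h, nbr g h -> (forall j, h <> v j) -> z <> x h).
  have [[i ->]|noti] := pselect (exists i, g = v i); last first.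
    have [|z] := @fresh_color n [:: x g]; first exact: leq_trans n4.
    by rewrite inE => /eqP zx; exists z; split.
  have [j ->] := vS i; have [o1 [o2 [_ o12]]] := deg4 j.
  have [//|z] := @fresh_color n [:: x (v j.+1); x o1; x o2].
  rewrite !inE !negb_or => /and3P[/eqP z0 /eqP z1 /eqP z2].
  exists z; split=> // _ h.
  by case/o12=> -> out //; [case: (out j)|case: (out j.+2)].
have [D DP] := choice freshD.
have [||||s [p [q [pq qK /= [eP eK]]]]] :=
    @cyclic_recoloring _ K (fun i => x (v i)) (fun i => D (v i)) K0.
- by move=> i; rewrite vK.
- by move=> i; rewrite vK.
- by move=> i; apply/eqP/nesym; case: (DP (v i)).
- by move=> i; apply/eqP/xP/v_nbr.
pose P g := exists2 i, p <= i <= q & g = v (s + i).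
pose y g := if `[< P g >] then D g else x g.
set e := fun i => if p <= i <= q then D (v (s + i)) else x (v (s + i))
  in eP eK.
have vy i : i <= K -> y (v (s + i)) = e i.
  move=> iK; rewrite /y /e; case: asboolP => [[j jpq /v_inj/eqP]|nP].
    rewrite eqn_modDl !modn_small; [move/eqP ->; rewrite jpq //|lia|lia].
  by case: ifP => // ipq; case: nP; exists i.
have v_mod i : v (i %% K.+1) = v i.
  rewrite [in RHS](divn_eq i K.+1) addnC.
  by elim: (i %/ _) => [|m IHm]; rewrite ?addn0 // mulSn addnCA addnC vK.
have v_eq i j : i = j %[mod K.+1] -> v i = v j.
  by move=> ij; rewrite -v_mod ij v_mod.
(* The rotated indices s, ..., s + K cover the cycle. *)
have vrot j : exists2 i, i <= K & v j = v (s + i).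
  exists ((j + s * K) %% K.+1); first by rewrite -ltnS ltn_mod.
  apply: v_eq; rewrite modnDmr addnCA -mulnS.
  by rewrite -modnDmr modnMl addn0.
(* Recolored along the arc, consecutive vertices still get distinct colors. *)
have y_edge j : y (v j) <> y (v j.+1).
  have [i iK vj] := vrot j.
  have vj1 : v j.+1 = v (s + i.+1).
    apply: v_eq; rewrite addnS -[j.+1]addn1 -[(s + i).+1]addn1.
    by rewrite -modnDml (v_inj _ _ vj) modnDml.
  apply/eqP; rewrite vj vj1 vy //.
  have [iltK|] := ltnP i K; first by rewrite vy ?eP.
  move=> Ki; have {iK Ki vj vj1}-> : i = K by apply/eqP; rewrite eqn_leq iK.
  by rewrite vK -[s in v s]addn0 vy.
have y_out g : (forall i, g <> v i) -> y g = x g.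
  by move=> out; rewrite /y; case: asboolP => // -[i _ /out].
have y_in g h : (exists i, g = v i) -> nbr g h -> y g <> y h.
  move=> [i ->]; have [j ->] := vS i; move=> {i} gh.
  have [[i hi]|out] := pselect (exists i, h = v i).
    rewrite {}hi in gh *; have [->|->] := chordless _ _ gh; last exact: y_edge.
    exact/nesym/y_edge.
  have {}out i : h <> v i by move=> hi; apply: out; exists i.
  rewrite (y_out _ out) /y; case: asboolP => _; last exact: xP.
  by case: (DP (v j.+1)) => _; apply=> //; exists j.+1.
exists y; split=> // [g h gh|yx].
  have [gv|gout] := pselect (exists i, g = v i); first exact: y_in.
  have [hv|hout] := pselect (exists i, h = v i); first exact/nesym/y_in/nbrC.
  rewrite !y_out; [exact: xP| |].
  - by move=> i hi; apply: hout; exists i.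
  - by move=> i gi; apply: gout; exists i.
have pK : p <= K by apply: leq_trans qK.
have := vy p pK; rewrite yx /e leqnn pq => /nesym.
by case: (DP (v (s + p))).
Qed.

(** * The Cayley graph and its affine coordinates *)

Definition bs_nbr (N : nat) (g h : BS N) : Prop :=
  [\/ h = (g * bs_a N)%g, h = (g * bs_b N)%g,
      g = (h * bs_a N)%g | g = (h * bs_b N)%g].

Lemma bs_nbr_sym N (g h : BS N) : bs_nbr g h -> bs_nbr h g.
Proof.
by case=> ?; [constructor 3|constructor 4|constructor 1|constructor 2].
Qed.

Lemma bs_nbrE N (g h : BS N) : bs_nbr g h ->
  [\/ h = (g * bs_a N)%g, h = (g * bs_b N)%g,
      h = (g * (bs_a N)^-1)%g | h = (g * (bs_b N)^-1)%g].
Proof.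
case=> [->|->|->|->]; first by constructor 1.
- by constructor 2.
- by constructor 3; rewrite mulgK.
- by constructor 4; rewrite mulgK.
Qed.

Lemma graph_coloringP N n (x : BS N -> 'I_n) :
  graph_coloring x <-> forall g h, bs_nbr g h -> x g <> x h.
Proof.
split=> [xP g h|xP g s [->|->]].
- case=> [->|->|->|->]; [|by apply: xP; right|apply/nesym|apply/nesym].
  + by apply: xP; left.
  + by apply: xP; left.
  + by apply: xP; right.
- by apply: xP; constructor 1.
- by apply: xP; constructor 2.
Qed.

Local Open Scope ring_scope.

(** Position (t, m) stands for the affine map x |-> N^m x + t; right
multiplication by a composes with x |-> x + 1, and by b with x |-> N x. *)
Definition affine_a (N : nat) (p : rat * int) : rat * int :=
  (p.1 + N%:R ^ p.2, p.2).
Definition affine_aV (N : nat) (p : rat * int) : rat * int :=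
  (p.1 - N%:R ^ p.2, p.2).
Definition affine_b (p : rat * int) : rat * int := (p.1, p.2 + 1).
Definition affine_bV (p : rat * int) : rat * int := (p.1, p.2 - 1).

Lemma affine_aK N : cancel (affine_a N) (affine_aV N).
Proof. by case=> t m; rewrite /affine_aV /= addrK. Qed.

Lemma affine_aVK N : cancel (affine_aV N) (affine_a N).
Proof. by case=> t m; rewrite /affine_a /= subrK. Qed.

Lemma affine_bK : cancel affine_b affine_bV.
Proof. by case=> t m; rewrite /affine_bV /= addrK. Qed.

Lemma affine_bVK : cancel affine_bV affine_b.
Proof. by case=> t m; rewrite /affine_b /= subrK. Qed.

Lemma affine_aX N k p : iter k (affine_a N) p = (p.1 + k%:R * N%:R ^ p.2, p.2).
Proof.
elim: k => [|k /= ->]; first by case: p => t m /=; rewrite mul0r addr0.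
by rewrite /affine_a /= -addrA -[k.+1%:R]natr1 mulrDl mul1r.
Qed.

Lemma affine_rel N (N_gt0 : (0 < N)%N) p :
  affine_bV (affine_a N (affine_b p)) = iter N (affine_a N) p.
Proof.
have N0 : N%:R != 0 :> rat by rewrite pnatr_eq0 -lt0n.
by rewrite affine_aX /affine_bV /= addrK exprzDr // expr1z mulrC.
Qed.

Definition affine_action N (N_gt0 : (0 < N)%N) : bs_action N (rat * int) :=
  BsAction (@affine_aK N) (@affine_aVK N) affine_bK affine_bVK
    (affine_rel N_gt0).

Lemma walk_aX N (N_gt0 : (0 < N)%N) k :
  walk (affine_action N_gt0) (0, 0) (bs_a N ^+ k)%g = (k%:R, 0).
Proof.
elim: k => [|k IHk]; first by rewrite expg0 walk1.
by rewrite expgSr walk_a IHk /= /affine_a /= expr0z natr1.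
Qed.

Lemma bs_baE N : (bs_b N * bs_a N = bs_a N ^+ N * bs_b N)%g.
Proof. by rewrite -bs_relation mulgVK. Qed.

(** * The relator cycle *)

(** The closed path that the relation b a b^-1 = a^N bounds in the Cayley graph;
indices are read modulo its length. *)
Definition relator_cycle (N i : nat) : BS N :=
  let r := (i %% N.+3)%N in
  if (r <= N)%N then (bs_a N ^+ r)%g
  else if r == N.+1 then (bs_a N ^+ N * bs_b N)%g else bs_b N.

Lemma relator_cycle_pos N (N_gt0 : (0 < N)%N) i :
  let r := (i %% N.+3)%N in
  walk (affine_action N_gt0) (0, 0) (relator_cycle N i)
  = if (r <= N)%N then (r%:R, 0) else if r == N.+1 then (N%:R, 1) else (0, 1).
Proof.
move=> r; rewrite /relator_cycle -/r; case: ifP => _; first exact: walk_aX.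
case: ifP => _; first by rewrite walk_b walk_aX.
by rewrite -[bs_b N]mul1g walk_b walk1.
Qed.

Lemma relator_cycle_inj N i j : (0 < N)%N ->
  relator_cycle N i = relator_cycle N j -> i = j %[mod N.+3].
Proof.
move=> N_gt0 /(congr1 (walk (affine_action N_gt0) (0, 0))).
rewrite !relator_cycle_pos; have := ltn_pmod i (ltn0Sn N.+2).
have := ltn_pmod j (ltn0Sn N.+2).
have nat_inj (k l : nat) : k%:R = l%:R :> rat -> k = l.
  by move/eqP; rewrite eqr_nat => /eqP.
move: (i %% _)%N (j %% _)%N => r s.
case: (leqP r N); case: (leqP s N).
- by move=> _ _ _ _ [/nat_inj].
- by case: ifP.
- by case: ifP.
- case: eqVneq => [->|rN]; case: eqVneq => [->|sN] //; last by lia.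
    by move=> _ _ _ _ [/(nat_inj _ 0%N)]; lia.
  by move=> _ _ _ _ [/(nat_inj 0%N)]; lia.
Qed.

Lemma relator_cycle_path N i :
  bs_nbr (relator_cycle N i) (relator_cycle N i.+1).
Proof.
rewrite /relator_cycle -[i.+1]addn1 -modnDml addn1.
have := ltn_pmod i (ltn0Sn N.+2); move: (i %% _)%N => r rN.
have [ltrN|gtrN|->] := ltngtP r N.
- rewrite modn_small; last lia.
  by rewrite ltrN; constructor 1; rewrite expgSr.
- have [->|->] : r = N.+1 \/ r = N.+2 by lia.
    rewrite eqxx modn_small // ifF; last lia.
    by rewrite ifF; [constructor 3; rewrite bs_baE|lia].
  rewrite modnn /= ifF; last lia.
  by constructor 4; rewrite expg0 mul1g.
- rewrite modn_small; last lia.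
  by rewrite ltnn eqxx; constructor 2.
Qed.

(** The cycle is induced, and exactly two of the four neighbors of each of its
vertices are off it: the affine coordinates tell the outer neighbors from the
vertices of the cycle. *)
Lemma relator_cycle_nbrs N i : (0 < N)%N ->
  exists o1 o2,
     (forall j, o1 <> relator_cycle N j /\ o2 <> relator_cycle N j) /\
     (forall h, bs_nbr (relator_cycle N i.+1) h ->
        [\/ h = relator_cycle N i, h = relator_cycle N i.+2, h = o1 | h = o2]).
Proof.
move=> N_gt0; set P := walk (affine_action N_gt0) (0, 0).
have aX k : P (bs_a N ^+ k)%g = (k%:R, 0) := walk_aX N_gt0 k.
(* The cycle lies at positions (0, 0), ..., (N, 0), (N, 1) and (0, 1). *)
have off o (t m : int) : P o = (t%:~R, m) ->
    (m = 0 -> t < 0 \/ N%:Z < t) -> (m = 1 -> t <> 0 /\ t <> N) ->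
    forall j, o <> relator_cycle N j.
  move=> Po m0 m1 j oj; move: Po; rewrite oj /P relator_cycle_pos.
  case: ifP => [jN|_]; last case: ifP => _.
  - by case=> /eqP; rewrite pmulrn eqr_int => /eqP ? ?; lia.
  - by case=> /eqP; rewrite pmulrn eqr_int => /eqP ? ?; lia.
  - by case=> /eqP; rewrite eq_sym intr_eq0 => /eqP ? ?; lia.
have Pa g t m : P g = (t, m) -> P (g * bs_a N)%g = (t + N%:R ^ m, m).
  by rewrite /P walk_a => ->.
have PaV g t m : P g = (t, m) -> P (g * (bs_a N)^-1)%g = (t - N%:R ^ m, m).
  by rewrite /P walk_aV => ->.
have Pb g t m : P g = (t, m) -> P (g * bs_b N)%g = (t, m + 1).
  by rewrite /P walk_b => ->.
have PbV g t m : P g = (t, m) -> P (g * (bs_b N)^-1)%g = (t, m - 1).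
  by rewrite /P walk_bV => ->.
have aXV k : (0 < k)%N -> (bs_a N ^+ k * (bs_a N)^-1 = bs_a N ^+ k.-1)%g.
  by case: k => // k _; rewrite expgSr mulgK.
have rN : (i.+1 %% N.+3 < N.+3)%N by rewrite ltn_mod.
have : (i.+2 %% N.+3 = if i.+1 %% N.+3 == N.+2 then 0 else (i.+1 %% N.+3).+1)%N.
  rewrite -[i.+2]addn1 -modnDml addn1; case: eqP => [->|ne]; first exact: modnn.
  by rewrite modn_small //; lia.
have : (i %% N.+3 = if i.+1 %% N.+3 == 0 then N.+2 else (i.+1 %% N.+3).-1)%N.
  rewrite -[i.+1]addn1 -modnDml addn1; have := ltn_pmod i (ltn0Sn N.+2).
  move: (i %% _)%N => p pN; have [pl|pg] := ltnP p N.+2.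
    by rewrite modn_small.
  by have -> : p = N.+2; [lia|rewrite modnn].
pose u k := if (k <= N)%N then (bs_a N ^+ k)%g
            else if k == N.+1 then (bs_a N ^+ N * bs_b N)%g else bs_b N.
have uE k : relator_cycle N k = u (k %% N.+3)%N by [].
have u_aX k : (k <= N)%N -> u k = (bs_a N ^+ k)%g by rewrite /u => ->.
have u_ab : u N.+1 = (bs_a N ^+ N * bs_b N)%g by rewrite /u ltnn eqxx.
have u_b : u N.+2 = bs_b N.
  by rewrite /u ifF; [rewrite ifF //; lia|lia].
rewrite (uE i) (uE i.+1) (uE i.+2) => -> ->.
move: (i.+1 %% _)%N rN => r rN.
have [r0|r_gt0] := posnP r.
  (* the vertex 1 *)
  rewrite {}r0 /= u_b !u_aX // expg0 expg1.
  exists (1 * (bs_a N)^-1)%g, (1 * (bs_b N)^-1)%g.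
  split=> [j|h /bs_nbrE]; last by case=> ->; rewrite ?mul1g;
    [constructor 2|constructor 1|constructor 3|constructor 4].
  have P1 : P 1%g = (0, 0) := aX 0%N.
  split; [apply: (off _ (-1) 0)|apply: (off _ 0 (-1))]; try lia.
    by rewrite (PaV _ _ _ P1).
  by rewrite (PbV _ _ _ P1).
case: (ltngtP r N) => [ltrN|gtrN|eqrN].
- (* the vertices a^r with 0 < r < N *)
  rewrite ifF; last lia.
  rewrite !u_aX; [|lia..].
  exists (bs_a N ^+ r * bs_b N)%g, (bs_a N ^+ r * (bs_b N)^-1)%g.
  split=> [j|h /bs_nbrE].
    split; [apply: (off _ r 1)|apply: (off _ r (-1))]; try lia.
      by rewrite (Pb _ _ _ (aX r)).
    by rewrite (PbV _ _ _ (aX r)).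
  case=> ->; [constructor 2|constructor 3|constructor 1|constructor 4] => //.
    by rewrite expgSr.
  exact: aXV.
- have [r1|r2] : r = N.+1 \/ r = N.+2 by lia.
    (* the vertex a^N b = b a *)
    rewrite {}r1 ifF; last lia.
    rewrite u_ab u_b /= u_aX //.
    have Pu := Pb _ _ _ (aX N); rewrite add0r in Pu.
    exists (bs_a N ^+ N * bs_b N * bs_a N)%g, (bs_a N ^+ N * bs_b N * bs_b N)%g.
    split=> [j|h /bs_nbrE].
      split; [apply: (off _ (N + N)%N 1)|apply: (off _ N 2)]; try lia.
        by rewrite (Pa _ _ _ Pu) expr1z -natrD.
      by rewrite (Pb _ _ _ Pu).
    case=> ->; [constructor 3|constructor 4|constructor 2|constructor 1] => //.
      by rewrite -bs_baE mulgK.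
    by rewrite mulgK.
  (* the vertex b *)
  rewrite {}r2 eqxx u_b u_ab u_aX // expg0.
  have Pu := Pb _ _ _ (aX 0%N); rewrite add0r expg0 mul1g in Pu.
  exists (bs_b N * (bs_a N)^-1)%g, (bs_b N * bs_b N)%g.
  split=> [j|h /bs_nbrE].
    split; [apply: (off _ (- N%:Z) 1)|apply: (off _ 0 2)]; try lia.
      by rewrite (PaV _ _ _ Pu) expr1z sub0r rmorphN.
    by rewrite (Pb _ _ _ Pu).
  case=> ->; [constructor 1|constructor 4|constructor 3|constructor 2] => //.
    exact: bs_baE.
  by rewrite mulgV.
- (* the vertex a^N *)
  rewrite {}eqrN ifF; last lia.
  rewrite u_ab !u_aX ?leq_pred //.
  exists (bs_a N ^+ N * bs_a N)%g, (bs_a N ^+ N * (bs_b N)^-1)%g.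
  split=> [j|h /bs_nbrE].
    split; [apply: (off _ N.+1 0)|apply: (off _ N (-1))]; try lia.
      by rewrite (Pa _ _ _ (aX N)) expr0z natr1.
    by rewrite (PbV _ _ _ (aX N)).
  case=> ->; [constructor 3|constructor 2|constructor 1|constructor 4] => //.
  exact: aXV.
Qed.

Lemma not_frozen_coloring N n (x : BS N -> 'I_n) :
  (0 < N)%N -> (3 < n)%N -> ~ frozen_coloring x.
Proof.
move=> N_gt0 n_gt3 [/graph_coloringP xP x_frozen].
have vmod i : relator_cycle N (i %% N.+3) = relator_cycle N i.
  by rewrite /relator_cycle modn_mod.
have [|y [yP yx y_out]] := @recolor_induced_cycle (BS N) n N.+2 (@bs_nbr N) x
    (relator_cycle N) n_gt3 isT (@bs_nbr_sym N) xP _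
    (fun i j => @relator_cycle_inj N i j N_gt0) (relator_cycle_path N)
    (fun i => relator_cycle_nbrs i N_gt0).
  by move=> i; rewrite -[LHS]vmod modnDr vmod.
apply: yx; apply: x_frozen; first exact/graph_coloringP.
exists [set relator_cycle N k | k in `I_N.+3]%classic; split.
- by exists (relator_cycle N 0), 0%N.
- exact/finite_image/finite_II.
- move=> g /= gF; rewrite y_out // => i gi; apply: gF.
  by exists (i %% N.+3)%N; rewrite ?gi //= ltn_mod.
Qed.

(** * Frozen 3-colorings *)

Lemma seq_max_rank (T : eqType) (disp : Order.disp_t) (R : orderType disp)
    (f : T -> R) (s : seq T) g0 :
  g0 \in s -> exists2 g, g \in s & forall h, h \in s -> (f h <= f g)%O.
Proof.
elim: s g0 => // h [|h' s] IHs g0 _.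
  by exists h; rewrite ?mem_head // => k; rewrite inE => /eqP ->.
have [g gs gmax] := IHs h' (mem_head _ _).
have [hg|/ltW gh] := leP (f h) (f g).
  exists g; first by rewrite in_cons gs orbT.
  by move=> k; rewrite in_cons => /predU1P[->|/gmax].
exists h; first exact: mem_head.
by move=> k; rewrite in_cons => /predU1P[->|/gmax/le_trans-> //].
Qed.

Lemma I3_unique (a b c d : 'I_3) :
  c <> d -> a <> c -> a <> d -> b <> c -> b <> d -> a = b.
Proof.
move=> /eqP cd /eqP ac /eqP ad /eqP bc /eqP bd; apply/val_inj.
move: cd ac ad bc bd (ltn_ord a) (ltn_ord b) (ltn_ord c) (ltn_ord d).
by rewrite -!val_eqE /=; lia.
Qed.

(** In a finite set of modified vertices take one of maximal rank: its two
differently colored neighbors of larger rank keep their colors, and with three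
colors this determines its own. *)
Lemma frozen_of_rank N (disp : Order.disp_t) (R : orderType disp)
    (x : BS N -> 'I_3) (f : BS N -> R) :
  graph_coloring x ->
  (forall g, exists h1 h2, [/\ bs_nbr g h1, bs_nbr g h2, x h1 <> x h2,
                             (f g < f h1)%O & (f g < f h2)%O]) ->
  frozen_coloring x.
Proof.
move=> xP up; split=> // y yP [F [_ /finite_seqP[s Fs] xy]].
apply/funext => g0; apply: contrapT => /eqP yx0.
pose D := [seq g <- s | y g != x g].
have DP g : (g \in D) = (y g != x g).
  rewrite mem_filter; have [//|/= ne] := eqVneq (y g) (x g).
  apply: contrapT => /negP gs; move/eqP: ne; apply.
  by rewrite xy // Fs /=; apply/negP.
have [|g gD gmax] := @seq_max_rank _ _ _ f D g0; first by rewrite DP.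
have [h1 [h2 [n1 n2 x12 f1 f2]]] := up g.
have yxh h : (f g < f h)%O -> y h = x h.
  move=> fgh; apply/eqP/negPn; rewrite -DP; apply/negP => /gmax.
  by rewrite leNgt fgh.
have /graph_coloringP yN := yP; have /graph_coloringP xN := xP.
move: gD; rewrite DP => /eqP; apply; apply: (I3_unique x12).
- by rewrite -yxh //; apply: yN.
- by rewrite -yxh //; apply: yN.
- exact: xN.
- exact: xN.
Qed.

(** The state (exponent of a modulo N - 1, exponent of b modulo 3) for
N = M + 3. The relation holds because N = 1 modulo N - 1. *)
Definition cycle_action M : bs_action M.+3 ('I_M.+2 * 'Z_3).
Proof.
refine (@BsAction M.+3 ('I_M.+2 * 'Z_3)%type
  (fun s => (s.1 + 1, s.2)) (fun s => (s.1 - 1, s.2))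
  (fun s => (s.1, s.2 + 1)) (fun s => (s.1, s.2 - 1)) _ _ _ _ _).
- by case=> c z; rewrite /= addrK.
- by case=> c z; rewrite /= subrK.
- by case=> c z; rewrite /= addrK.
- by case=> c z; rewrite /= subrK.
case=> c z; transitivity (c + M.+3%:R, z).
  have M0 : M.+2%:R = 0 :> 'I_M.+2 by apply/val_inj; rewrite Zp_nat /= modnn.
  by rewrite /= addrK -[M.+3]addn1 natrD M0 add0r.
elim: M.+3 => [|k IHk]; first by rewrite addr0.
by rewrite /= -IHk /= -addrA natr1.
Defined.

(** Alternate 0 and 1 around the cycle and put 2 on its last vertex, which
breaks the parity obstruction when the length is odd. *)
Definition cycle_coloring M (c : 'I_M.+2) : 'Z_3 :=
  if c == ord_max then 2%:R else (odd c)%:R.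

Lemma cycle_coloring_step M (c : 'I_M.+2) :
  cycle_coloring (c + 1) - cycle_coloring c = 1 \/
  cycle_coloring (c + 1) - cycle_coloring c = -1.
Proof.
have : c + 1 = (if c == M.+1 :> nat then 0 else c.+1)%N :> nat.
  rewrite /= [(1 %% _)%N]modn_small // addn1; case: eqP => [->|ne].
    exact: modnn.
  by rewrite modn_small //; have := ltn_ord c; lia.
move: (c + 1) => e eE; rewrite /cycle_coloring -!val_eqE /= {}eE.
have [cM|cM] := eqVneq (c : nat) M.+1; first by left; apply/val_inj.
have [c1|c1] := eqVneq c.+1 M.+1.
  by case: (odd c); [left|right]; apply/val_inj.
by rewrite /=; case: (odd c); [right|left]; apply/val_inj.
Qed.

Lemma frozen_coloring_ge3 M : exists x : BS M.+3 -> 'I_3, frozen_coloring x.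
Proof.
pose A := cycle_action M; pose Q := affine_action (ltn0Sn M.+2).
pose st := walk A (0, 0); pose pos := walk Q (0, 0).
pose w := @cycle_coloring M.
pose x (g : BS M.+3) : 'Z_3 := (st g).2 + w (st g).1.
(* [up g] says that the color goes up along a; it depends only on the column
   of g, because the state [(st g).1] is constant along b. *)
pose up (g : BS M.+3) := w ((st g).1 + 1) - w (st g).1 == 1.
pose rank (g : BS M.+3) : (rat *l int) :=
   ((pos g).1, if up g then - (pos g).2 else (pos g).2).
have sta g : st (g * bs_a _)%g = ((st g).1 + 1, (st g).2) by rewrite /st walk_a.
have stb g : st (g * bs_b _)%g = ((st g).1, (st g).2 + 1) by rewrite /st walk_b.
have stbV g : st (g * (bs_b _)^-1)%g = ((st g).1, (st g).2 - 1).
  by rewrite /st walk_bV.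
have xa g : x (g * bs_a _)%g = x g + (if up g then 1 else -1).
  rewrite /x /up sta /=; have := cycle_coloring_step (st g).1; rewrite -/w.
  case: eqP => [e _|ne [//|e]]; apply/eqP; rewrite -subr_eq0 -e; apply/eqP; ring.
have xb g : x (g * bs_b _)%g = x g + 1 by rewrite /x stb /= addrAC.
have xbV g : x (g * (bs_b _)^-1)%g = x g - 1 by rewrite /x stbV /= addrAC.
exists x; apply: (@frozen_of_rank _ _ _ _ rank).
  move=> g s [->|->] /eqP; rewrite ?xa ?xb -subr_eq0.
    by case: ifP => _; rewrite opprD addNKr.
  by rewrite opprD addNKr.
move=> g; exists (g * bs_a _)%g.
exists (if up g then g * (bs_b _)^-1 else g * bs_b _)%g; split.
- by constructor 1.
- by case: ifP => _; [constructor 4; rewrite mulgVK|constructor 2].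
- case: ifP => ug; rewrite xa ug ?xb ?xbV.
    by move/addrI.
  by move/addrI.
- rewrite ltEprodlexi /rank /pos walk_a /= lerDl ltW ?exprz_gt0 ?ltr0n //.
  by rewrite gerDl leNgt exprz_gt0 ?ltr0n.
- rewrite /rank /pos; case: ifP => ug; rewrite ltEprodlexi /up ?stb ?stbV.
    by rewrite walk_bV /= -/(up g) ug lexx; lia.
  by rewrite walk_b /= -/(up g) ug lexx; lia.
Qed.

Definition flip_sign (s : bool) : 'Z_3 := (-1) ^+ s.

(** Both sides change the color by the opposite of the current sign: b a b^-1
because it applies a with the flipped sign, a^2 because 2 = -1 modulo 3. *)
Lemma flip_rel (z : 'Z_3 * bool) :
  (z.1 - 1 + flip_sign (~~ z.2) + 1, ~~ ~~ z.2)
  = (z.1 + flip_sign z.2 + flip_sign z.2, z.2).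
Proof.
case: z => c [] /=; rewrite addrAC subrK -?addrA; congr (_ + _, _);
  exact/val_inj.
Qed.

Definition flip_action : bs_action 2 ('Z_3 * bool).
Proof.
refine (@BsAction 2 ('Z_3 * bool)%type
  (fun z => (z.1 + flip_sign z.2, z.2)) (fun z => (z.1 - flip_sign z.2, z.2))
  (fun z => (z.1 - 1, ~~ z.2)) (fun z => (z.1 + 1, ~~ z.2)) _ _ _ _ flip_rel).
- by case=> c z; rewrite /= addrK.
- by case=> c z; rewrite /= subrK.
- by case=> c z; rewrite /= negbK subrK.
- by case=> c z; rewrite /= negbK addrK.
Defined.

Lemma frozen_coloring_2 : exists x : BS 2 -> 'I_3, frozen_coloring x.
Proof.
pose A := flip_action; pose Q := affine_action (isT : 0 < 2)%N.
pose st := walk A (0, false); pose pos := walk Q (0, 0).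
pose x (g : BS 2) : 'Z_3 := (st g).1.
pose rank (g : BS 2) : (int *l rat) :=
   ((pos g).2, if (st g).2 then - (pos g).1 else (pos g).1).
have xa g : x (g * bs_a _)%g = x g + flip_sign (st g).2.
  by rewrite /x /st walk_a.
have xaV g : x (g * (bs_a _)^-1)%g = x g - flip_sign (st g).2.
  by rewrite /x /st walk_aV.
have xb g : x (g * bs_b _)%g = x g - 1 by rewrite /x /st walk_b.
exists x; apply: (@frozen_of_rank _ _ _ _ rank).
  move=> g s [->|->] /eqP; rewrite ?xa ?xb -subr_eq0 opprD addNKr oppr_eq0.
    by rewrite /flip_sign signr_eq0.
  by rewrite oppr_eq0 oner_eq0.
move=> g; exists (g * bs_b _)%g.
exists (if (st g).2 then g * (bs_a _)^-1 else g * bs_a _)%g; split.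
- by constructor 2.
- by case: ifP => _; [constructor 3; rewrite mulgVK|constructor 1].
- by case: ifP => sg; rewrite xb ?xa ?xaV sg => /addrI.
- by rewrite ltEprodlexi /rank /pos walk_b /=; lia.
- rewrite /rank /pos /st; case: ifP => sg;
    rewrite ltEprodlexi ?walk_aV ?walk_a /= sg.
    by rewrite lexx /= opprB ltrDr exprz_gt0.
  by rewrite lexx /= ltrDl exprz_gt0.
Qed.

Local Close Scope ring_scope.

Theorem theorem1p2 (N n : nat) (hN : 2 <= N) (hn : 3 <= n) :
  (exists x : BS N -> 'I_n, frozen_coloring x) <-> n = 3.
Proof.
split=> [[x x_frozen]|->].
  apply/eqP; rewrite eqn_leq hn andbT leqNgt; apply/negP => n_gt3.
  exact: not_frozen_coloring (ltnW hN) n_gt3 x_frozen.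
case: N hN => [|[|[|M]]] // _; first exact: frozen_coloring_2.
exact: frozen_coloring_ge3.
Qed.
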